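(* Let $R$ be a finite commutative ring with identity $1$, let $R^{+}$ be its additive group, $R^{\ast}$ its group of units, and $I:=R\setminus R^{\ast}$. Let $N\le R^{\ast}$ be a subgroup and let $S$ be a complete system of representatives of $R^{\ast}/N$. Let $\mathcal F=\{D_i \mid 1\le i\le b\}$ be an $(R^{+},\{k_i\mid 1\le i\le b\},\lambda)$-DF, and assume that each $D_i$ is fixed by $N$, i.e. $xD_i=D_i$ for all $x\in N$. Define subsets of $N$ by $$D_{i,y}:=y^{-1}(D_i-1)\cap N\qquad (1\le i\le b,\ y\in S),$$ put $k_{i,y}:=|D_{i,y}|$ and $\mathcal F'=\{D_{i,y}\mid 1\le i\le b;\ y\in S\}$. Then for every $t\in N\setminus\{1\}$, $$\theta_{\mathcal F'}(t)=\lambda-\lambda_t,\qquad\text{where}\qquad \lambda_t:=\sum_{i=1}^{b}\bigl|D_i\cap (D_i-t+1)\cap (I+1)\bigr|.$$ If $\lambda_t$ takes a constant value $\nu$ for all $t\in N\setminus\{1\}$, then $\mathcal F'$ is an $(N,\{k_{i,y}\mid 1\le i\le b;\ y\in S\},\lambda-\nu)$-DF. If $L$ is a subgroup of $N$ such that $\lambda-\lambda_t$ equals a constant $\mu$ for all $t\in N\setminus L$ and a constant $\eta$ for all $t\in L\setminus\{1\}$, then $\mathcal F'$ is an $(N,L,\{k_{i,y}\mid 1\le i\le b;\ y\in S\},\eta,\mu)$-DDF.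
   Context: Let $(G,\cdot)$ be a finite abelian group with identity $1$, and $N$ a subgroup of $G$. Let $\mathcal F=\{D_i\mid 1\le i\le b\}$ be an indexed family of subsets (''blocks'') of $G$ with $|D_i|=k_i$. For $d\in G$ put $\theta_i(d)=|\{(x,y)\mid x,y\in D_i,\ x\ne y,\ xy^{-1}=d\}|$ and $\theta_{\mathcal F}(d)=\sum_{i=1}^b\theta_i(d)$. The family $\mathcal F$ is a $(G,N,\{k_1,\dots,k_b\},\lambda,\mu)$ divisible difference family (DDF) if $\theta_{\mathcal F}(d)=\lambda$ for all $d\in N\setminus\{1\}$ and $\theta_{\mathcal F}(d)=\mu$ for all $d\in G\setminus N$. The list $\{k_1,\dots,k_b\}$ is a multiset. When $N=\{1\}$, it is called a $(G,\{k_1,\dots,k_b\},\lambda)$ difference family (DF): $\theta_{\mathcal F}(d)=\lambda$ for all $d\ne 1$. For additive groups, $xy^{-1}$ is read as $x-y$ and the identity is $0$. For a subset $D$ of a ring and elements $c,x$: $D+c=\{d+c\mid d\in D\}$, $xD=\{xd\mid d\in D\}$. *)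

(* Defs.v *)
From HB Require Import structures.
From mathcomp Require Import all_boot all_order all_fingroup all_algebra.

Set Implicit Arguments.
Unset Strict Implicit.
Unset Printing Implicit Defensive.

Import GRing.Theory.
Local Open Scope ring_scope.

(* Groups are written multiplicatively. For a finite ring R, the group law
   of the canonical finGroupType on R is addition, so [set: R]%G is the
   additive group of R, and there x * y^-1 is x - y and 1%g is 0. *)
Section DifferenceFamilies.

Variables (gT : finGroupType) (J : finType).
Implicit Types (G N : {group gT}) (D : {set gT}) (F : J -> {set gT}).

Definition theta_block D (d : gT) : nat :=
  #|[set p : gT * gT | [&& p.1 \in D, p.2 \in D, p.1 != p.2
                         & (p.1 * p.2^-1)%g == d]]|.

Definition theta F (d : gT) : nat := (\sum_(i : J) theta_block (F i) d)%N.

(* A multiset of block sizes is a list up to permutation. The parameters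
   [lam] and [mu] are integers so that differences of parameters are not
   truncated. *)
Definition is_DDF G N F (K : seq nat) (lam mu : int) : Prop :=
  [/\ abelian G /\ N \subset G,
      forall i, F i \subset G,
      perm_eq [seq #|F i| | i : J] K,
      forall d, d \in N -> d != 1%g -> (theta F d)%:Z = lam
    & forall d, d \in G -> d \notin N -> (theta F d)%:Z = mu].

Definition is_DF G F (K : seq nat) (lam : int) : Prop :=
  [/\ abelian G,
      forall i, F i \subset G,
      perm_eq [seq #|F i| | i : J] K
    & forall d, d \in G -> d != 1%g -> (theta F d)%:Z = lam].

End DifferenceFamilies.

Section Ring.

Variable R : finComUnitRingType.
Implicit Types (D : {set R}) (N S : {set {unit R}}).

Definition shift D (c : R) : {set R} := [set d + c | d in D].

Definition scale (x : R) D : {set R} := [set x * d | d in D].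

Definition nonunits : {set R} := [set x : R | x \isn't a GRing.unit].

Definition unit_block N D (y : {unit R}) : {set {unit R}} :=
  [set u in N | val u \in scale (val y)^-1 (shift D (-1))].

Definition unit_family b (D : 'I_b -> {set R}) N S
    (p : 'I_b * {y : {unit R} | y \in S}) : {set {unit R}} :=
  unit_block N (D p.1) (val p.2).

Definition lambda_at b (D : 'I_b -> {set R}) (t : {unit R}) : nat :=
  (\sum_(i < b)
     #|(D i :&: shift (D i) (- val t + 1) :&: shift nonunits 1)%R|)%N.

End Ring.

(* Main.v *)
Require Import Defs.
From HB Require Import structures.
From mathcomp Require Import all_boot all_order all_fingroup all_algebra.

(** Fix [t] in [N] with [t != 1]. The number of pairs in [D_{i,y}] with quotient
    [t] is the number of [v] in [N] such that both [1 + y v] and [1 + y t v]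
    lie in [D_i]. Every unit is [w = v y] for exactly one [v] in [N] and [y] in
    [S], so summing over [y] counts the units [w] for which [1 + w] and
    [1 + t w] lie in [D_i] ([theta_unit_family]).

    On the additive side, [t - 1] is nonzero, so the difference family property
    gives [lam] elements [e] with [e] and [t - 1 + e] in [D_i], summed over [i]
    ([theta_blockE]). If [e - 1] is not a unit, then [e] is counted by
    [lambda_at D t]. If it is a unit, write [e = 1 + t w]; then
    [t - 1 + e = t (1 + w)], which lies in [D_i] if and only if [1 + w] does,
    because [t] fixes [D_i]. So the elements [e] of the second kind correspond
    to the units [w] counted above ([theta_block_unit_split]), which is the
    formula for the quotient counts; the two statements on families only
    substitute constants in it. *)

Set Implicit Arguments.
Unset Strict Implicit.
Unset Printing Implicit Defensive.

Import GRing.Theory.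
Local Open Scope ring_scope.

(** A pair with a given quotient is determined by its second entry, and its
    entries are distinct as soon as the quotient is not the identity. *)
Lemma theta_blockE (gT : finGroupType) (D : {set gT}) (d : gT) : d != 1%g ->
  theta_block D d = #|[set v | (v \in D) && ((d * v)%g \in D)]|.
Proof.
move=> d1; have inj : injective (fun v : gT => ((d * v)%g, v)) by move=> u v [].
rewrite -(card_imset _ inj); apply: eq_card => -[x v]; rewrite !inE /=.
apply/and4P/imsetP => [[Dx Dv _ /eqP <-]|[u]].
  by exists v; rewrite ?inE mulgKV // Dv.
rewrite inE => /andP[Du Ddu] [-> ->]; split=> //; last by rewrite mulgK.
by apply: contra d1 => /eqP duu; rewrite -(mulgK u d) duu mulgV.
Qed.

(** The cosets [N :* y] with [y] in the transversal partition [G], and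
    [v |-> v * y] is a bijection from [N] to [N :* y]. *)
Lemma card_sum_transversal (gT : finGroupType) (G N : {group gT})
    (S A : {set gT}) :
    is_transversal S (rcosets N G) G -> A \subset G ->
  #|A| = (\sum_(y in S) #|[set v in N | (v * y)%g \in A]|)%N.
Proof.
move=> trS sAG; have /and3P[partP /subsetP sSG _] := trS.
have /and3P[_ tiP _] := partP.
have -> : #|A| = (\sum_(x in G) (x \in A))%N.
  rewrite -sum1_card big_mkcond [RHS]big_mkcond; apply: eq_bigr => x _ /=.
  by case: ifP => [/(subsetP sAG) ->|]; last by rewrite if_same.
rewrite (set_partition_big _ partP) -{1}(pblock_transversal trS).
rewrite (big_imset _ (pblock_inj trS)); apply: eq_bigr => y Sy.
rewrite (@def_pblock _ _ (N :* y)%g) ?rcoset_refl //; last first.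
  by apply/rcosetsP; exists y; rewrite ?sSG.
rewrite -sum1_card -rcosetE big_imset /=; last by move=> u v _ _ /mulIg.
rewrite big_mkcond [RHS]big_mkcond; apply: eq_bigr => v _ /=.
by rewrite inE; do 2 case: (_ \in _).
Qed.

Section UnitBlocks.

Variable R : finComUnitRingType.
Implicit Types (D : {set R}) (N S : {set {unit R}}) (t u v w y : {unit R}).

Lemma unit_mulC u v : (u * v)%g = (v * u)%g.
Proof. by apply: val_inj; rewrite !FinRing.val_unitM mulrC. Qed.

Lemma abelian_unit N : abelian N.
Proof. by apply/centsP => u _ v _; apply: unit_mulC. Qed.

(** Here [1%g] is the identity of the additive group of [R], that is, [0]. *)
Lemma val_unit_subr1_neq0 t : t != 1%g -> val t - 1 != 1%g :> R.
Proof.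
by rewrite subr_eq0; apply: contra => /eqP vt1; apply/eqP/val_inj.
Qed.

Lemma mem_shift D (c x : R) : (x \in shift D c) = (x - c \in D).
Proof.
apply/imsetP/idP => [[d Dd ->]|Dx]; first by rewrite addrK.
by exists (x - c); rewrite ?subrK.
Qed.

Lemma mem_scale_inv D u (x : R) : (x \in scale (val u)^-1 D) = (val u * x \in D).
Proof.
apply/imsetP/idP => [[d Dd ->]|Dx]; first by rewrite mulVKr ?(valP u).
by exists (val u * x); rewrite ?mulKr ?(valP u).
Qed.

Lemma mem_unit_block N D y v :
  (v \in unit_block N D y) = (v \in N) && (1 + val (v * y)%g \in D).
Proof.
by rewrite inE mem_scale_inv mem_shift opprK addrC FinRing.val_unitM mulrC.
Qed.

Lemma mem_fixed_scale D t (x : R) :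
  scale (val t) D = D -> (val t * x \in D) = (x \in D).
Proof.
move=> tD; rewrite -{1}tD; apply/imsetP/idP => [[d Dd]|Dx]; last by exists x.
by move=> /(mulrI (valP t)) ->.
Qed.

Definition unit_pairs D t : {set {unit R}} :=
  [set w | (1 + val w \in D) && (1 + val (t * w)%g \in D)].

(** The pairs in the block at [y] correspond to the members of [unit_pairs D t]
    in the coset [N :* y], by [v |-> v * y]. *)
Lemma sum_theta_unit_block (N : {group {unit R}}) S D t :
    is_transversal S (rcosets N [set: {unit R}]) [set: {unit R}] ->
    t \in N -> t != 1%g ->
  (\sum_(y in S) theta_block (unit_block N D y) t)%N = #|unit_pairs D t|.
Proof.
move=> trS Nt t1; rewrite (card_sum_transversal (G := [set: _]) trS) ?subsetT //.
apply: eq_bigr => y _; rewrite theta_blockE //; apply: eq_card => v.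
by rewrite in_set !mem_unit_block groupMl // !inE mulgA; case: (v \in N).
Qed.

Lemma theta_unit_family (N : {group {unit R}}) S b (D : 'I_b -> {set R}) t :
    is_transversal S (rcosets N [set: {unit R}]) [set: {unit R}] ->
    t \in N -> t != 1%g ->
  theta (@unit_family R b D N S) t = (\sum_(i < b) #|unit_pairs (D i) t|)%N.
Proof.
move=> trS Nt t1; transitivity
  (\sum_(i < b) \sum_(y : {y | y \in S})
     theta_block (unit_block N (D i) (val y)) t)%N; first by rewrite pair_bigA.
apply: eq_bigr => i _; rewrite -(sum_theta_unit_block (D i) trS Nt t1).
by rewrite [RHS]big_sub.
Qed.

(** The elements counted for the additive difference [t - 1] are divided
    according to whether [e - 1] is a unit. Writing a unit [e - 1] as [t w],
    and not as [w], makes the condition on [t - 1 + e = t (1 + w)] a condition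
    on [1 + w], by invariance under [t]. *)
Lemma theta_block_unit_split D t : t != 1%g -> scale (val t) D = D ->
  theta_block D (val t - 1) =
    (#|unit_pairs D t| +
     #|(D :&: shift D (- val t + 1) :&: shift (nonunits R) 1)%R|)%N.
Proof.
move=> t1 tD; rewrite (theta_blockE D (val_unit_subr1_neq0 t1)) -[LHS](cardsID (shift (nonunits R) 1)) addnC.
congr (_ + _)%N; last first.
  apply: eq_card => e; rewrite !in_setI !inE !mem_shift FinRing.zmodMgE.
  by rewrite opprD opprK (addrC _ e).
have inj : injective (fun w : {unit R} => 1 + val (t * w)%g).
  by move=> u v /addrI /val_inj /mulgI.
rewrite -[RHS](card_imset _ inj); apply: eq_card => e.
rewrite in_setD mem_shift !inE negbK FinRing.zmodMgE.
have shiftE w : val t - 1 + (1 + val (t * w)%g) = val t * (1 + val w).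
  by rewrite FinRing.val_unitM mulrDr mulr1 addrA subrK.
apply/and3P/imsetP => [[Ue De Dte]|[w]]; last first.
  rewrite inE => /andP[Dw Dtw] ->; split=> //.
    by rewrite addrAC subrr add0r (valP (t * w)%g).
  by rewrite shiftE mem_fixed_scale.
pose w := (t^-1 * FinRing.unit R Ue)%g.
have eE : e = 1 + val (t * w)%g by rewrite mulKVg /= addrC subrK.
by exists w; rewrite // inE -eE De -(mem_fixed_scale _ tD) -shiftE -eE Dte.
Qed.

End UnitBlocks.

Theorem lemma2p1 (R : finComUnitRingType) (N : {group {unit R}})
    (S : {set {unit R}})
    (hS : is_transversal S (rcosets N [set: {unit R}]) [set: {unit R}])
    (b : nat) (D : 'I_b -> {set R}) (lam : int)
    (hD : is_DF [set: R]%G D [seq #|D i| | i : 'I_b] lam)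
    (hN : forall (i : 'I_b) (x : {unit R}), x \in N -> scale (val x) (D i) = D i) :
  let F' := @unit_family R b D N S in
  let K' := [seq #|F' p| | p : ('I_b * {y : {unit R} | y \in S})%type] in
  [/\ forall t : {unit R}, t \in N -> t != 1%g ->
        (theta F' t)%:Z = lam - (lambda_at D t)%:Z,
      forall nu : int,
        (forall t : {unit R}, t \in N -> t != 1%g -> (lambda_at D t)%:Z = nu) ->
        is_DF N F' K' (lam - nu)
    & forall (L : {group {unit R}}) (mu eta : int),
        L \subset N ->
        (forall t : {unit R}, t \in N -> t \notin L ->
           lam - (lambda_at D t)%:Z = mu) ->
        (forall t : {unit R}, t \in L -> t != 1%g ->
           lam - (lambda_at D t)%:Z = eta) ->
        is_DDF N L F' K' eta mu].
Proof.
move=> F' K'.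
have thetaF' t : t \in N -> t != 1%g ->
    (theta F' t)%:Z = lam - (lambda_at D t)%:Z.
  move=> Nt t1; have [_ _ _ thetaD] := hD.
  rewrite -(thetaD (val t - 1)) ?inE ?val_unit_subr1_neq0 // theta_unit_family //.
  rewrite /theta /lambda_at (eq_bigr _ (fun i _ =>
    theta_block_unit_split t1 (hN i t Nt))) big_split /=.
  by rewrite PoszD addrK.
have sF'N p : F' p \subset N by apply/subsetP => u; rewrite inE => /andP[].
split=> // [nu lamE | L mu eta sLN lamN lamL].
  by split=> //; [apply: abelian_unit | move=> t Nt t1; rewrite thetaF' ?lamE].
split=> //; first by split; first apply: abelian_unit.
  by move=> t Lt t1; rewrite thetaF' ?lamL // (subsetP sLN).
move=> t Nt nLt; rewrite thetaF' ?lamN //.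
by apply: contraNneq nLt => ->; apply: group1.
Qed.
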